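(* Let $G$ be a commutative group and let $h\colon R\to S$ be a morphism of $G$-graded commutative rings. For $G$-graded $R$-modules $M$ and $N$ there is a morphism $$\delta^h_{M,N}\colon h^*(M)\otimes_Sh^*(N)\to h^*(M\otimes_RN)$$ in $\mathrm{Mod}^G(S)$ with $(r\otimes x)\otimes(s\otimes y)\mapsto(rs)\otimes(x\otimes y)$ for homogeneous $r,s\in S$, $x\in M$, $y\in N$; it is natural in $M$ and $N$, and it is an isomorphism, with inverse the morphism $h^*(M\otimes_RN)\to h^*(M)\otimes_Sh^*(N)$ given by $s\otimes(x\otimes y)\mapsto s((1_S\otimes x)\otimes(1_S\otimes y))$. In particular there is an isomorphism of bifunctors $\delta^h\colon h^*(\bullet)\otimes_Sh^*(\bullet')\cong h^*(\bullet\otimes_R\bullet')$.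
   Context: All groups and rings are commutative (rings unital). $\mathrm{Mod}^G(R)$ is the category of $G$-graded $R$-modules with degree-preserving $R$-linear maps. The tensor product $M\otimes_RN$ is graded with $x\otimes y$ in degree $\deg x+\deg y$. $h_*\colon\mathrm{Mod}^G(S)\to\mathrm{Mod}^G(R)$ is restriction of scalars along $h$, and $h^*\colon\mathrm{Mod}^G(R)\to\mathrm{Mod}^G(S)$ is $h^*(M)=S\otimes_RM$ (the graded tensor product $h_*(S)\otimes_RM$ with $s(t\otimes x)=(st)\otimes x$). *)

(* Defs.v *)
From HB Require Import structures.
From mathcomp Require Import all_boot all_algebra.
From mathcomp Require Import boolp.
From mathcomp Require Import finmap.
From mathcomp.multinomials Require Import monalg.

Set Implicit Arguments.
Unset Strict Implicit.
Unset Printing Implicit Defensive.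

Import GRing.Theory.
Local Open Scope ring_scope.
Local Open Scope quotient_scope.

(* Rings are comPzRingType rather than comNzRingType: the zero ring is a
   commutative unital ring. *)

(* The additive subgroup generated by P. *)
Definition zspan (V : zmodType) (P : V -> Prop) : {pred V} := fun v =>
  `[< forall A : {pred V}, zmod_closed A -> (forall w, P w -> w \in A) ->
        v \in A >].

Section ZSpan.
Variables (V : zmodType) (P : V -> Prop).

Lemma zspan_closed : zmod_closed (zspan P).
Proof.
split; first by apply/asboolP => A [].
move=> x y /asboolP Px /asboolP Py; apply/asboolP => A Ac PA.
by have [_ AB] := Ac; apply: AB; [apply: Px | apply: Py].
Qed.

HB.instance Definition _ := GRing.isZmodClosed.Build V (zspan P) zspan_closed.

Lemma zspan_gen v : P v -> v \in zspan P.
Proof. by move=> Pv; apply/asboolP => A _; apply. Qed.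

Lemma zspan_min (A : {pred V}) :
  zmod_closed A -> (forall w, P w -> w \in A) -> {subset zspan P <= A}.
Proof. by move=> Ac PA v /asboolP; apply. Qed.

Lemma zspan_ind (Q : V -> Prop) :
  Q 0 -> (forall x y, Q x -> Q y -> Q (x - y)) -> (forall w, P w -> Q w) ->
  forall v, v \in zspan P -> Q v.
Proof.
move=> Q0 QB QP v vP; apply/asboolP.
apply: (@zspan_min (fun x => `[< Q x >]) _ _ v vP).
  by split=> [|x y /asboolP Qx /asboolP Qy]; apply/asboolP; auto.
by move=> w /QP Qw; apply/asboolP.
Qed.

End ZSpan.

Section ZmodMorphism.
Variables (U V : zmodType) (f : U -> V).
Hypothesis fB : zmod_morphism f.

Lemma zmod_morphism0 : f 0 = 0.
Proof. by rewrite -(subrr 0) fB subrr. Qed.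

Lemma zmod_morphismD : {morph f : x y / x + y}.
Proof.
have fN x : f (- x) = - f x by rewrite -sub0r fB zmod_morphism0 sub0r.
by move=> x y; rewrite -[y]opprK fB !fN !opprK.
Qed.

End ZmodMorphism.

(* The tensor product is the quotient of the free abelian group on M * N by
   the biadditivity and balancing relations; R acts by
   r *: (x (x) y) = (r *: x) (x) y. *)

Section Tensor.
Variables (R : comPzRingType) (M N : lmodType R).

Let F : zmodType := monalg.malg (M * N)%type int.
Let gen (x : M) (y : N) : F := monalg.mkmalgU (x, y) 1.

Inductive tensor_relation : F -> Prop :=
| TensorAddl x x' y :
    tensor_relation (gen (x + x') y - gen x y - gen x' y)
| TensorAddr x y y' :
    tensor_relation (gen x (y + y') - gen x y - gen x y')
| TensorBal (r : R) x y :
    tensor_relation (gen (r *: x) y - gen x (r *: y)).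

Definition tensor : Type := Quotient.quot (zspan tensor_relation).
HB.instance Definition _ := GRing.Zmodule.on tensor.

Let T : zmodType := tensor.
Let pi (f : F) : T := \pi_(Quotient.quot (zspan tensor_relation)) f.

Definition tens (x : M) (y : N) : tensor := pi (gen x y).

Let pi_is_additive : zmod_morphism pi.
Proof. exact: (raddfB (\pi_(Quotient.quot (zspan tensor_relation)))). Qed.
#[local] HB.instance Definition _ :=
  GRing.isZmodMorphism.Build F T pi pi_is_additive.

Let pi_eq0 f : f \in zspan tensor_relation -> pi f = 0.
Proof.
move=> fP; rewrite -(raddf0 pi); apply/eqP.
by rewrite -Quotient.idealrBE subr0.
Qed.

Lemma tensDl x x' y : tens (x + x') y = tens x y + tens x' y.
Proof.
apply/eqP; rewrite -subr_eq0 opprD addrA /tens -!raddfB.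
by rewrite /= pi_eq0 //; apply/zspan_gen/TensorAddl.
Qed.

Lemma tensDr x y y' : tens x (y + y') = tens x y + tens x y'.
Proof.
apply/eqP; rewrite -subr_eq0 opprD addrA /tens -!raddfB.
by rewrite /= pi_eq0 //; apply/zspan_gen/TensorAddr.
Qed.

Lemma tens_bal (r : R) x y : tens (r *: x) y = tens x (r *: y).
Proof.
apply/eqP; rewrite -subr_eq0 /tens -!raddfB.
by rewrite /= pi_eq0 //; apply/zspan_gen/TensorBal.
Qed.

Let F_ind (Q : F -> Prop) :
  Q 0 -> (forall x y, Q x -> Q y -> Q (x - y)) -> (forall x y, Q (gen x y)) ->
  forall v, Q v.
Proof.
move=> Q0 QB Qg v; have QN x : Q x -> Q (- x).
  by move=> Qx; rewrite -sub0r; apply: QB.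
have QD x y : Q x -> Q y -> Q (x + y).
  by move=> Qx Qy; rewrite -[y]opprK; apply: QB => //; apply: QN.
rewrite (monalg.monalgE v); elim/big_ind: _ => // -[x y] _.
have -> (z : int) : monalg.mkmalgU (x, y) z = gen x y *~ z.
  by rewrite -[z in LHS]intz raddfMz.
have Qn n : Q (gen x y *+ n).
  by elim: n => [|n IH]; rewrite ?mulr0n ?mulrS //; apply: QD.
by case: (monalg.mcoeff _ _) => n; [exact: Qn | apply/QN/Qn].
Qed.

Lemma tensor_ind (Q : tensor -> Prop) :
  Q 0 -> (forall x y, Q x -> Q y -> Q (x - y)) -> (forall x y, Q (tens x y)) ->
  forall t, Q t.
Proof.
move=> Q0 QB Qt t; rewrite -[t]reprK.
change (Q (pi (repr t))); elim/F_ind: (repr t) => [|x y Qx Qy|x y].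
- by rewrite raddf0.
- by rewrite raddfB; apply: QB.
- exact: Qt.
Qed.

Section Lift.
Variables (A : zmodType) (phi : M -> N -> A).

Definition balanced := [/\ forall x x' y, phi (x + x') y = phi x y + phi x' y,
  forall x y y', phi x (y + y') = phi x y + phi x y' &
  forall r x y, phi (r *: x) y = phi x (r *: y)].

Let flift (f : F) : A :=
  \sum_(k <- monalg.msupp f) phi k.1 k.2 *~ monalg.mcoeff k f.

Let fliftEw (d : {fset M * N}) f : (monalg.msupp f `<=` d)%fset ->
  flift f = \sum_(k <- d) phi k.1 k.2 *~ monalg.mcoeff k f.
Proof.
move=> le; rewrite [LHS](big_fset_incl _ le) => //= x xd /monalg.mcoeff_outdom ->.
by rewrite mulr0z.
Qed.

Let flift_is_additive : zmod_morphism flift.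
Proof.
move=> f g; pose d := (monalg.msupp f `|` monalg.msupp g)%fset.
rewrite (@fliftEw d f) ?fsubsetUl // (@fliftEw d g) ?fsubsetUr //.
rewrite (@fliftEw d) ?monalg.msuppB_le // -sumrB.
by apply: eq_bigr => k _; rewrite monalg.mcoeffB mulrzBr.
Qed.
#[local] HB.instance Definition _ :=
  GRing.isZmodMorphism.Build F A flift flift_is_additive.

Let flift_gen x y : flift (gen x y) = phi x y.
Proof.
rewrite (fliftEw monalg.msuppU_le) big_seq_fset1.
by rewrite monalg.mcoeffUU.
Qed.

Definition tlift (t : tensor) : A := flift (repr t).

Hypothesis phiB : balanced.

Let flift_ker f : f \in zspan tensor_relation -> flift f = 0.
Proof.
have [phiDl phiDr phiZ] := phiB.
move: f; apply: zspan_ind => [|x y fx fy|w [x x' y|x y y'|r x y]].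
- exact: raddf0.
- by rewrite raddfB /= fx fy subr0.
- by rewrite !raddfB /= !flift_gen phiDl addrAC addrK subrr.
- by rewrite !raddfB /= !flift_gen phiDr addrAC addrK subrr.
- by rewrite raddfB /= !flift_gen phiZ subrr.
Qed.

Let tlift_pi f : tlift (pi f) = flift f.
Proof.
apply/eqP; rewrite -subr_eq0 /tlift -raddfB /=; apply/eqP/flift_ker.
by rewrite Quotient.idealrBE reprK.
Qed.

Lemma tlift_tens x y : tlift (tens x y) = phi x y.
Proof. by rewrite tlift_pi flift_gen. Qed.

Lemma tlift_is_additive : zmod_morphism tlift.
Proof.
move=> t u; rewrite -[t in LHS]reprK -[u in LHS]reprK.
by rewrite -[LHS]/(tlift (pi (repr t) - pi (repr u))) -raddfB tlift_pi raddfB.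
Qed.

End Lift.

Let tscale (r : R) : tensor -> tensor := tlift (fun x y => tens (r *: x) y).

Let tscaleP r : balanced (fun x y => tens (r *: x) y).
Proof.
split=> [x x' y|x y y'|a x y]; first by rewrite scalerDr tensDl.
  exact: tensDr.
by rewrite scalerA mulrC -scalerA tens_bal.
Qed.

Let tscaleB r : zmod_morphism (tscale r).
Proof. exact: tlift_is_additive (tscaleP r). Qed.
Let tscale0 r : tscale r 0 = 0.
Proof. exact: zmod_morphism0 (tscaleB r). Qed.

Let tscale_tens r x y : tscale r (tens x y) = tens (r *: x) y.
Proof. exact: tlift_tens (tscaleP r) _ _. Qed.

Let tscaleA a b t : tscale a (tscale b t) = tscale (a * b) t.
Proof.
elim/tensor_ind: t => [|t u IHt IHu|x y]; first by rewrite !tscale0.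
  by rewrite !tscaleB IHt IHu.
by rewrite !tscale_tens scalerA.
Qed.

Let tscale1 : left_id 1 tscale.
Proof.
elim/tensor_ind => [|t u IHt IHu|x y]; first by rewrite !tscale0.
  by rewrite !tscaleB IHt IHu.
by rewrite !tscale_tens scale1r.
Qed.

Let tscaleDr : right_distributive tscale +%R.
Proof. by move=> r t u; exact: (zmod_morphismD (tscaleB r)). Qed.

Let tscaleDl t : {morph tscale^~ t : a b / a + b}.
Proof.
move=> a b; elim/tensor_ind: t => [|t u IHt IHu|x y].
- by rewrite !tscale0 addr0.
- by rewrite !tscaleB IHt IHu opprD addrACA.
- by rewrite !tscale_tens scalerDl tensDl.
Qed.

HB.instance Definition _ := GRing.Zmodule_isLmodule.Build R tensor
  tscaleA tscale1 tscaleDr tscaleDl.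

Lemma scale_tens (r : R) x y : r *: tens x y = tens (r *: x) y.
Proof. exact: tscale_tens. Qed.

End Tensor.

(* The family D realizes V as the internal direct sum of the subgroups D g. *)
Definition direct_sum (G : choiceType) (V : zmodType) (D : G -> {pred V}) :=
  (forall g, zmod_closed (D g)) /\
  forall v, exists! c : {fsfun G -> V with 0},
    (forall g, c g \in D g) /\ v = \sum_(g <- finsupp c) c g.

Lemma big_supp (I : eqType) (V : zmodType) (s d : seq I) (F : I -> V) :
  uniq s -> uniq d -> {subset s <= d} -> (forall i, i \notin s -> F i = 0) ->
  \sum_(i <- d) F i = \sum_(i <- s) F i.
Proof.
move=> us ud sd F0; rewrite (bigID (mem s)) /= [X in _ + X]big1 // addr0.
rewrite -big_filter; apply: perm_big; apply: uniq_perm => //.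
  exact: filter_uniq.
by move=> i; rewrite mem_filter /=; case: (boolP (i \in s)) => // /sd ->.
Qed.

Section DirectSum.
Variables (G : choiceType) (V : zmodType) (D : G -> {pred V}).

Lemma direct_sum_proj (p : G -> V -> V) :
  (forall g, zmod_closed (D g)) ->
  (forall v, v \in zspan (fun w => exists g, w \in D g)) ->
  (forall g, zmod_morphism (p g)) ->
  (forall g h v, v \in D h -> p g v = if g == h then v else 0) ->
  direct_sum D.
Proof.
move=> Dz Dspan pB pD; split=> // v.
have p0 g : p g 0 = 0 by apply: zmod_morphism0 (pB g).
have pDD g := zmod_morphismD (pB g).
have psum g (s : seq G) (c : G -> V) :
    p g (\sum_(i <- s) c i) = \sum_(i <- s) p g (c i).
  by apply: (big_morph (p g) (pDD g) (p0 g)).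
have D0 g : 0 \in D g by have [] := Dz g.
suff [d [pd sd vd]] : exists d : {fset G},
    [/\ forall g, p g v \in D g, forall g, g \notin d -> p g v = 0
      & v = \sum_(g <- d) p g v].
  pose c0 : {fsfun G -> V with 0} := [fsfun g in d => p g v].
  have cE g : c0 g = p g v.
    by rewrite fsfunE; case: ifPn => // /sd ->.
  exists c0; split.
    split=> [g|]; first by rewrite cE.
    rewrite [LHS]vd (eq_bigr _ (fun g _ => cE g)).
    apply: big_supp => // [g|g].
      by rewrite mem_finsupp cE; apply: contraNT => /sd ->.
    by rewrite memNfinsupp cE => /eqP.
  move=> c [cD vE]; apply/fsfunP => g.
  rewrite cE vE psum; under eq_bigr => i _ do rewrite (pD _ _ _ (cD i)).
  rewrite -big_mkcond /=; case: (boolP (g \in finsupp c)) => gc.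
    by rewrite (big_rem g) //= eqxx big1_seq ?addr0 // => i /andP[/eqP <-];
       rewrite mem_rem_uniqF.
  rewrite big1_seq ?(fsfun_dflt gc) // => i /andP[/eqP <-].
  by rewrite (negPf gc).
have := Dspan v; move: v.
apply: zspan_ind => [|x y [d [pd sd xd]] [e [pe se ye]]|w [h wh]].
- exists fset0; split=> [g|g _|]; rewrite ?p0 //.
  by rewrite big_seq_fset0.
- exists (d `|` e)%fset; split=> [g|g|]; rewrite ?pB.
  + by have [_] := Dz g; apply.
  + by rewrite in_fsetU negb_or => /andP[/sd -> /se ->]; rewrite subr0.
  rewrite (eq_bigr _ (fun g _ => pB g x y)) sumrB; congr (_ - _).
  + by rewrite [LHS]xd; apply/esym/big_supp => // g; rewrite in_fsetU => ->.
  + by rewrite [LHS]ye; apply/esym/big_supp => // g; rewrite in_fsetU orbC => ->.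
- exists [fset h]%fset; split=> [g|g|]; rewrite ?(pD _ _ _ wh).
  + by case: eqP => [->|].
  + by rewrite in_fset1 => /negPf ->.
  + by rewrite big_seq_fset1 (pD _ _ _ wh) eqxx.
Qed.

Hypothesis DV : direct_sum D.

Let compP v := cid (DV.2 v).
Definition component (v : V) : {fsfun G -> V with 0} := sval (compP v).

Lemma component_in v g : component v g \in D g.
Proof. by have [[]] := svalP (compP v). Qed.

Lemma component_sum v : v = \sum_(g <- finsupp (component v)) component v g.
Proof. by have [[]] := svalP (compP v). Qed.

Lemma component_unique v (f : G -> V) (d : seq G) : uniq d ->
  (forall g, f g \in D g) -> (forall g, g \notin d -> f g = 0) ->
  v = \sum_(g <- d) f g -> forall g, component v g = f g.
Proof.
move=> ud fD f0 vE g.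
pose c : {fsfun G -> V with 0} := [fsfun g in seq_fset tt d => f g].
have cE i : c i = f i.
  by rewrite fsfunE seq_fsetE; case: ifPn => // /f0 ->.
have [_ cU] := svalP (compP v); rewrite -cE /component (cU c) //.
split=> [i|]; first by rewrite cE.
rewrite (eq_bigr _ (fun g _ => cE g)) vE; apply: big_supp => // [i|i].
  by rewrite mem_finsupp cE; apply: contraNT => /f0 ->.
by rewrite memNfinsupp cE => /eqP.
Qed.

Lemma component_sumw v (d : seq G) : uniq d ->
  {subset finsupp (component v) <= d} -> v = \sum_(g <- d) component v g.
Proof.
move=> ud sd; rewrite {1}(component_sum v); apply/esym/big_supp => // g.
by rewrite memNfinsupp => /eqP.
Qed.

Lemma componentB g u v : component (u - v) g = component u g - component v g.
Proof.
pose d := (finsupp (component u) `|` finsupp (component v))%fset.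
apply: (@component_unique _ (fun g => component u g - component v g) d) => //.
- by move=> i; have [_] := DV.1 i; apply; apply: component_in.
- move=> i; rewrite in_fsetU negb_or => /andP[iu iv].
  by rewrite !fsfun_dflt // subr0.
- rewrite sumrB -!component_sumw // => i; rewrite in_fsetU => -> //.
  by rewrite orbT.
Qed.

Lemma component_homog a v : v \in D a ->
  forall g, component v g = if g == a then v else 0.
Proof.
move=> va; apply: (@component_unique _ _ [:: a]) => //.
- by move=> g; case: eqP => [->|_] //; have [] := DV.1 g.
- by move=> g; rewrite inE => /negPf ->.
- by rewrite big_seq1 eqxx.
Qed.

Lemma direct_sum_ind (Q : V -> Prop) :
  Q 0 -> (forall x y, Q x -> Q y -> Q (x + y)) ->
  (forall g x, x \in D g -> Q x) -> forall v, Q v.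
Proof.
move=> Q0 QD QG v; rewrite (component_sum v).
by elim/big_ind: _ => // g _; apply/QG/component_in.
Qed.

End DirectSum.

(* That 1 has degree 0 follows from gr_direct and gr_mul, G being a group. *)
Record gradedRing (G : zmodType) := GradedRing {
  gr_ring :> comPzRingType;
  gr_deg : G -> {pred gr_ring};
  gr_direct : direct_sum gr_deg;
  gr_mul : forall a b x y, x \in gr_deg a -> y \in gr_deg b ->
    x * y \in gr_deg (a + b)
}.
Arguments gr_deg {G} R g : rename.

Record gradedRingHom (G : zmodType) (R S : gradedRing G) := GradedRingHom {
  grh_fun :> {rmorphism R -> S};
  grh_deg : forall a x, x \in gr_deg R a -> grh_fun x \in gr_deg S a
}.

Record gradedModule (G : zmodType) (R : gradedRing G) := GradedModule {
  gm_mod :> lmodType R;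
  gm_deg : G -> {pred gm_mod};
  gm_direct : direct_sum gm_deg;
  gm_scale : forall a b (r : R) x, r \in gr_deg R a -> x \in gm_deg b ->
    r *: x \in gm_deg (a + b)
}.
Arguments gm_deg {G R} M g : rename.

Definition ring_homogeneous (G : zmodType) (R : gradedRing G) (r : R) :=
  exists a, r \in gr_deg R a.

Definition homogeneous (G : zmodType) (R : gradedRing G) (M : gradedModule R)
  (x : M) := exists a, x \in gm_deg M a.

Record gradedHom (G : zmodType) (R : gradedRing G) (M N : gradedModule R) :=
GradedHom {
  gh_fun :> M -> N;
  gh_linear : linear gh_fun;
  gh_deg : forall a x, x \in gm_deg M a -> gh_fun x \in gm_deg N a
}.

HB.instance Definition _ (G : zmodType) (R : gradedRing G)
    (M N : gradedModule R) (f : gradedHom M N) :=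
  GRing.isLinear.Build R M N *:%R (gh_fun f) (gh_linear f).

Section GradedHom.
Variables (G : zmodType) (R : gradedRing G).

Lemma gradedHom_eq (M N : gradedModule R) (f g : gradedHom M N) :
  f =1 g -> f = g.
Proof.
case: f g => [f fl fd] [g gl gd] /= /funext fg; subst g.
by congr GradedHom; apply: Prop_irrelevance.
Qed.

Definition gid (M : gradedModule R) : gradedHom M M :=
  @GradedHom G R M M id (fun _ _ _ => erefl) (fun _ _ => id).

Section Comp.
Variables (M N P : gradedModule R) (f : gradedHom N P) (g : gradedHom M N).

Lemma gcomp_linear : linear (f \o g).
Proof. by move=> a x y; rewrite /= !linearP. Qed.

Lemma gcomp_deg a x : x \in gm_deg M a -> (f \o g) x \in gm_deg P a.
Proof. by move=> xa; apply/gh_deg/gh_deg. Qed.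

Definition gcomp : gradedHom M P := GradedHom gcomp_linear gcomp_deg.

End Comp.

End GradedHom.

Section TensorMap.
Variables (R : comPzRingType).

Lemma tens_is_additiver (M N : lmodType R) (x : M) :
  zmod_morphism (@tens R M N x).
Proof.
have tN y : tens x (- y) = - tens x y :> tensor M N.
  by apply: (addIr (tens x y)); rewrite -tensDr !addNr; apply: (addIr (tens x 0));
     rewrite -tensDr !add0r.
by move=> y z; rewrite tensDr tN.
Qed.
HB.instance Definition _ (M N : lmodType R) (x : M) :=
  GRing.isZmodMorphism.Build N (tensor M N) (@tens R M N x)
    (@tens_is_additiver M N x).

Lemma tens0r (M N : lmodType R) (x : M) : tens x (0 : N) = 0.
Proof. exact: raddf0. Qed.

Lemma tens0l (M N : lmodType R) (y : N) : tens (0 : M) y = 0.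
Proof. by rewrite -(scale0r 0) tens_bal scale0r tens0r. Qed.

Lemma tensBl (M N : lmodType R) (x x' : M) (y : N) :
  tens (x - x') y = tens x y - tens x' y.
Proof. by apply/eqP; rewrite eq_sym subr_eq -tensDl subrK. Qed.

Variables (M N M' N' : lmodType R).
Variables (u : {linear M -> M'}) (v : {linear N -> N'}).

Definition tmap : tensor M N -> tensor M' N' :=
  tlift (fun x y => tens (u x) (v y)).

Let tmapP : balanced (fun x y => tens (u x) (v y)).
Proof.
split=> [x x' y|x y y'|r x y].
- by rewrite raddfD tensDl.
- by rewrite raddfD tensDr.
- by rewrite !linearZ tens_bal.
Qed.

Lemma tmap_tens x y : tmap (tens x y) = tens (u x) (v y).
Proof. exact: tlift_tens tmapP _ _. Qed.

Lemma tmapB : zmod_morphism tmap.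
Proof. exact: tlift_is_additive tmapP. Qed.
HB.instance Definition _ :=
  GRing.isZmodMorphism.Build (tensor M N) (tensor M' N') tmap tmapB.

Lemma tmapZ : scalable tmap.
Proof.
move=> r; elim/tensor_ind => [|t w IHt IHw|x y].
- by rewrite scaler0 !raddf0.
- by rewrite scalerBr !raddfB /= IHt IHw.
- by rewrite scale_tens !tmap_tens linearZ scale_tens.
Qed.
HB.instance Definition _ :=
  GRing.isScalable.Build R (tensor M N) (tensor M' N') *:%R tmap tmapZ.

End TensorMap.

Section GradedTensor.
Variables (G : zmodType) (R : gradedRing G) (M N : gradedModule R).

Definition tensor_deg (g : G) : {pred tensor M N} :=
  zspan (fun t => exists a b x y,
    [/\ x \in gm_deg M a, y \in gm_deg N b, a + b = g & t = tens x y]).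

Let comp_M := component (gm_direct M).
Let comp_N := component (gm_direct N).

Let phi (g : G) (x : M) (y : N) : tensor M N :=
  \sum_(a <- finsupp (comp_M x)) tens (comp_M x a) (comp_N y (g - a)).

Let phiEw g x y (d : seq G) : uniq d -> {subset finsupp (comp_M x) <= d} ->
  phi g x y = \sum_(a <- d) tens (comp_M x a) (comp_N y (g - a)).
Proof.
move=> ud sd; apply/esym/big_supp => [|//|//|a]; first exact: fset_uniq.
by rewrite memNfinsupp => /eqP ->; rewrite tens0l.
Qed.

Let phiBl g x x' y : phi g (x - x') y = phi g x y - phi g x' y.
Proof.
pose d := (finsupp (comp_M x) `|` finsupp (comp_M x') `|`
  finsupp (comp_M (x - x')))%fset.
have ud : uniq d by apply: fset_uniq.
rewrite !(@phiEw _ _ _ d) //; last 3 first.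
- by move=> a; rewrite !in_fsetU => ->; rewrite ?orbT.
- by move=> a; rewrite !in_fsetU => ->; rewrite ?orbT.
- by move=> a; rewrite !in_fsetU => ->; rewrite ?orbT.
by rewrite -sumrB; apply: eq_bigr => a _; rewrite /comp_M componentB tensBl.
Qed.

Let phiBr g x y y' : phi g x (y - y') = phi g x y - phi g x y'.
Proof.
by rewrite -sumrB; apply: eq_bigr => a _; rewrite /comp_N componentB raddfB.
Qed.

Let phi0l g y : phi g 0 y = 0.
Proof. exact: zmod_morphism0 (fun x x' => phiBl g x x' y). Qed.

Let phi0r g x : phi g x 0 = 0.
Proof. exact: zmod_morphism0 (phiBr g x). Qed.

Let phiDl g x x' y : phi g (x + x') y = phi g x y + phi g x' y.
Proof. exact: (zmod_morphismD (fun x x' => phiBl g x x' y)). Qed.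

Let phiDr g x y y' : phi g x (y + y') = phi g x y + phi g x y'.
Proof. exact: (zmod_morphismD (phiBr g x)). Qed.

Let comp_scale (P : gradedModule R) c (r : R) (x : P) a : r \in gr_deg R c ->
  component (gm_direct P) (r *: x) a = r *: component (gm_direct P) x (a - c).
Proof.
move=> rc; pose d := finsupp (component (gm_direct P) x).
apply: (@component_unique _ _ _ _ _
  (fun a => r *: component (gm_direct P) x (a - c)) [seq b + c | b <- d]).
- by rewrite (map_inj_uniq (@addIr _ c)); apply: fset_uniq.
- move=> g; have := gm_scale rc (component_in (gm_direct P) x (g - c)).
  by rewrite [c + _]addrC subrK.
- move=> g gd; rewrite (fsfun_dflt (k := g - c)) ?scaler0 //.
  by apply: contra gd => gd; apply/mapP; exists (g - c); rewrite ?subrK.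
- rewrite big_map -scaler_sumr; congr (_ *: _).
  rewrite {1}(component_sum (gm_direct P) x).
  by apply: eq_bigr => b _; rewrite addrK.
Qed.

Let phi_bal g r x y : phi g (r *: x) y = phi g x (r *: y).
Proof.
move: r x y; apply: (direct_sum_ind (gr_direct R)) => [x y|r s IHr IHs x y|].
- by rewrite !scale0r phi0l phi0r.
- by rewrite !scalerDl phiDl phiDr IHr IHs.
move=> c r rc x y; rewrite (@phiEw _ _ _ [seq b + c | b <- finsupp (comp_M x)]).
- rewrite big_map; apply: eq_bigr => b _.
  by rewrite /comp_M /comp_N !(comp_scale _ _ rc) addrK tens_bal opprD addrA.
- by rewrite (map_inj_uniq (@addIr _ c)); apply: fset_uniq.
- move=> a; rewrite mem_finsupp /comp_M (comp_scale _ _ rc) => nz.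
  apply/mapP; exists (a - c); rewrite ?subrK // mem_finsupp.
  by apply: contraNneq nz => ->; rewrite scaler0.
Qed.

Let phiP g : balanced (phi g).
Proof. by split=> *; [apply: phiDl | apply: phiDr | apply: phi_bal]. Qed.

Lemma tensor_direct : direct_sum tensor_deg.
Proof.
apply: (@direct_sum_proj _ _ _ (fun g => tlift (phi g))).
- by move=> g; apply: zspan_closed.
- elim/tensor_ind => [|t w IHt IHw|x y]; first exact: rpred0.
    exact: rpredB.
  move: x y; apply: (direct_sum_ind (gm_direct M)) => [y|x x' IHx IHx' y|].
  + by rewrite tens0l rpred0.
  + by rewrite tensDl rpredD.
  move=> a x xa; apply: (direct_sum_ind (gm_direct N)) => [|y y' IHy IHy'|b y yb].
  + by rewrite tens0r rpred0.
  + by rewrite tensDr rpredD.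
  apply: zspan_gen; exists (a + b); apply: zspan_gen.
  by exists a, b, x, y.
- by move=> g; apply: tlift_is_additive (phiP g).
- move=> g h; have lB := tlift_is_additive (phiP g).
  have l0 := zmod_morphism0 lB.
  apply: zspan_ind => [|t w IHt IHw|_ [a [b [x [y [xa yb <- ->]]]]]].
  + by rewrite if_same.
  + by rewrite lB IHt IHw; case: eqP => //; rewrite subr0.
  rewrite (tlift_tens (phiP g)) (@phiEw _ _ _ [:: a]) //.
    rewrite big_seq1 /comp_M /comp_N (component_homog _ xa) eqxx.
    by rewrite (component_homog _ yb) subr_eq addrC; case: eqP => //; rewrite tens0r.
  move=> c; rewrite mem_finsupp /comp_M (component_homog _ xa) inE.
  by apply: contraNT => /negPf ->.
Qed.

Lemma tensor_deg_scale a b (r : R) t : r \in gr_deg R a -> t \in tensor_deg b ->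
  r *: t \in tensor_deg (a + b).
Proof.
move=> ra; move: t; apply: zspan_ind => [|t w tP wP|_ [c [d [x [y [xc yd <- ->]]]]]].
- by rewrite scaler0 rpred0.
- by rewrite scalerBr rpredB.
rewrite scale_tens; apply: zspan_gen; exists (a + c), d, (r *: x), y.
by split; rewrite ?addrA //; apply: gm_scale.
Qed.

Definition gtensor : gradedModule R :=
  @GradedModule G R (tensor M N) tensor_deg tensor_direct tensor_deg_scale.

End GradedTensor.
Arguments tensor_deg {G R} M N g.

Section GradedTensorMap.
Variables (G : zmodType) (R : gradedRing G) (M N M' N' : gradedModule R).
Variables (u : gradedHom M M') (v : gradedHom N N').

Lemma tmap_deg a (t : gtensor M N) : t \in gm_deg (gtensor M N) a ->
  (tmap u v t : gtensor M' N') \in gm_deg (gtensor M' N') a.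
Proof.
move: t; apply: zspan_ind => [|t w tP wP|_ [b [c [x [y [xb yc <- ->]]]]]].
- by rewrite raddf0 rpred0.
- by rewrite raddfB rpredB.
rewrite tmap_tens; apply: zspan_gen; exists b, c, (u x), (v y).
by split=> //; apply: gh_deg.
Qed.

Definition gtensor_map : gradedHom (gtensor M N) (gtensor M' N') :=
  @GradedHom G R (gtensor M N) (gtensor M' N') (tmap u v) (linearP (tmap u v))
    tmap_deg.

End GradedTensorMap.

(* An alias whose parameter h is what selects the R-module structure of M. *)
Definition restr (R S : comPzRingType) (h : {rmorphism R -> S})
  (M : lmodType S) : Type := M.
Arguments restr {R S} h M.

Section Scalars.
Variables (R S : comPzRingType) (h : {rmorphism R -> S}).

HB.instance Definition _ (M : lmodType S) := GRing.Zmodule.on (restr h M).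

Section RestrLmodule.
Variable M : lmodType S.
Let rscale (r : R) (x : restr h M) : restr h M := h r *: (x : M).
Let rscaleA a b x : rscale a (rscale b x) = rscale (a * b) x.
Proof. by rewrite /rscale scalerA rmorphM. Qed.
Let rscale1 : left_id 1 rscale.
Proof. by move=> x; rewrite /rscale rmorph1 scale1r. Qed.
Let rscaleDr : right_distributive rscale +%R.
Proof. by move=> r x y; rewrite /rscale scalerDr. Qed.
Let rscaleDl x : {morph rscale^~ x : a b / a + b}.
Proof. by move=> a b; rewrite /rscale rmorphD scalerDl. Qed.
HB.instance Definition _ := GRing.Zmodule_isLmodule.Build R (restr h M)
  rscaleA rscale1 rscaleDr rscaleDl.
End RestrLmodule.

Lemma restr_scale (M : lmodType S) (r : R) (x : restr h M) :
  r *: x = h r *: (x : M) :> M.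
Proof. by []. Qed.

(* S (x)_R M with its S-module structure s *: (t (x) x) = (s * t) (x) x, under
   a name of its own because the instances on tensor make it an R-module. *)
Definition extscal (M : lmodType R) : Type := tensor (restr h S^o) M.

HB.instance Definition _ (M : lmodType R) := GRing.Zmodule.on (extscal M).

Definition etens (M : lmodType R) (s : S) (x : M) : extscal M :=
  tens (s : restr h S^o) x.

Section ExtLmodule.
Variable M : lmodType R.

Let emul_fun (s : S) (t : restr h S^o) : restr h S^o := s * t.
Let emul_is_linear s : linear (emul_fun s).
Proof.
move=> r t t'; rewrite /emul_fun [LHS]mulrDr; congr (_ + _).
by rewrite !restr_scale /GRing.scale /= mulrCA.
Qed.
Let emul (s : S) : {linear restr h S^o -> restr h S^o} :=
  HB.pack (emul_fun s) (GRing.isLinear.Build R (restr h S^o) (restr h S^o) *:%R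
    (emul_fun s) (emul_is_linear s)).

Let escale (s : S) (t : extscal M) : extscal M :=
  tmap (emul s) (@idfun M) t.

Let escale_tens s t x : escale s (etens t x) = etens (s * t) x.
Proof. exact: tmap_tens. Qed.

Let escaleB s : zmod_morphism (escale s).
Proof. exact: tmapB. Qed.
Let escale0 s : escale s 0 = 0.
Proof. exact: zmod_morphism0 (escaleB s). Qed.

Lemma extscal_ind (Q : extscal M -> Prop) :
  Q 0 -> (forall x y, Q x -> Q y -> Q (x - y)) -> (forall s x, Q (etens s x)) ->
  forall t, Q t.
Proof. exact: tensor_ind. Qed.

Let escaleA a b t : escale a (escale b t) = escale (a * b) t.
Proof.
elim/extscal_ind: t => [|t u IHt IHu|s x]; first by rewrite !escale0.
  by rewrite !escaleB IHt IHu.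
by rewrite !escale_tens mulrA.
Qed.

Let escale1 : left_id 1 escale.
Proof.
elim/extscal_ind => [|t u IHt IHu|s x]; first by rewrite !escale0.
  by rewrite !escaleB IHt IHu.
by rewrite !escale_tens mul1r.
Qed.

Let escaleDr : right_distributive escale +%R.
Proof. by move=> r t u; exact: (zmod_morphismD (escaleB r)). Qed.

Let escaleDl t : {morph escale^~ t : a b / a + b}.
Proof.
move=> a b; elim/extscal_ind: t => [|t u IHt IHu|s x].
- by rewrite !escale0 addr0.
- by rewrite !escaleB IHt IHu opprD addrACA.
- by rewrite !escale_tens mulrDl; apply: tensDl.
Qed.

HB.instance Definition _ := GRing.Zmodule_isLmodule.Build S (extscal M)
  escaleA escale1 escaleDr escaleDl.

Lemma scale_etens (s t : S) (x : M) : s *: etens t x = etens (s * t) x.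
Proof. exact: escale_tens. Qed.

End ExtLmodule.

End Scalars.

Arguments extscal {R S} h M.
Arguments etens {R S} h {M} s x.

Section GradedScalars.
Variables (G : zmodType) (R S : gradedRing G) (h : gradedRingHom R S).

Definition gregular : gradedModule S :=
  @GradedModule G S S^o (gr_deg S) (gr_direct S) (@gr_mul G S).

Lemma restr_deg_scale (M : gradedModule S) a b (r : R) (x : restr h M) :
  r \in gr_deg R a -> x \in gm_deg M b -> r *: x \in gm_deg M (a + b).
Proof. by move=> ra xb; apply: gm_scale => //; apply: grh_deg. Qed.

Definition grestr (M : gradedModule S) : gradedModule R :=
  @GradedModule G R (restr h M) (gm_deg M) (gm_direct M)
    (@restr_deg_scale M).

Lemma ext_deg_scale (M : gradedModule R) a b (s : S) (t : extscal h M) :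
  s \in gr_deg S a -> t \in tensor_deg (grestr gregular) M b ->
  s *: t \in tensor_deg (grestr gregular) M (a + b).
Proof.
move=> sa; move: t; apply: zspan_ind => [|t w tP wP|].
- by rewrite scaler0 rpred0.
- by rewrite scalerBr; apply: rpredB.
move=> _ [c [d [x [y [xc yd <- ->]]]]].
have -> : s *: (tens x y : extscal h M) = etens h (s * x) y by apply: scale_etens.
apply: zspan_gen; exists (a + c), d, (s * x), y.
by split; rewrite ?addrA //; apply: gr_mul.
Qed.

(* Same carrier and grading as gtensor (grestr gregular) M. *)
Definition gext (M : gradedModule R) : gradedModule S :=
  @GradedModule G S (extscal h M) (gm_deg (gtensor (grestr gregular) M))
    (gm_direct (gtensor (grestr gregular) M)) (@ext_deg_scale M).

Section GextMap.
Variables (M N : gradedModule R) (u : gradedHom M N).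

Let emap : gext M -> gext N := gtensor_map (gid (grestr gregular)) u.

Let emap_tens s x : emap (etens h s x) = etens h s (u x).
Proof. exact: tmap_tens. Qed.

Let emapB : zmod_morphism emap.
Proof. exact: (raddfB (gtensor_map (gid (grestr gregular)) u)). Qed.

Let emap0 : emap 0 = 0.
Proof. exact: zmod_morphism0 emapB. Qed.

Let emapZ (s : S) (t : gext M) : emap (s *: t) = s *: emap t.
Proof.
elim/extscal_ind: t => [|t t' IHt IHt'|t x].
- by rewrite emap0; transitivity (emap 0); [congr emap|]; rewrite ?emap0 scaler0.
- transitivity (emap (s *: (t : gext M) - s *: (t' : gext M))).
    by congr emap; apply: scalerBr.
  by rewrite !emapB IHt IHt' scalerBr.
- by rewrite [LHS](congr1 emap (scale_etens _ _ _ _)) !emap_tens scale_etens.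
Qed.

Lemma gext_map_linear : linear emap.
Proof. by move=> s x y; rewrite (zmod_morphismD emapB) emapZ. Qed.

Definition gext_map : gradedHom (gext M) (gext N) :=
  @GradedHom G S (gext M) (gext N) emap gext_map_linear
    (gh_deg (gtensor_map (gid (grestr gregular)) u)).

Lemma gext_map_tens s x : gext_map (etens h s x) = etens h s (u x).
Proof. exact: emap_tens. Qed.

End GextMap.

End GradedScalars.

Record category := Category {
  obj :> Type;
  hom : obj -> obj -> Type;
  idm : forall a, hom a a;
  cmp : forall a b c, hom b c -> hom a b -> hom a c;
  cmp_idl : forall a b (f : hom a b), cmp (idm b) f = f;
  cmp_idr : forall a b (f : hom a b), cmp f (idm a) = f;
  cmpA : forall a b c d (f : hom c d) (g : hom b c) (k : hom a b),
    cmp f (cmp g k) = cmp (cmp f g) k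
}.

Record functor (C D : category) := Functor {
  fobj :> C -> D;
  fmap : forall a b, hom a b -> hom (fobj a) (fobj b);
  fmap_id : forall a, fmap (idm a) = idm (fobj a);
  fmap_cmp : forall a b c (f : hom b c) (g : hom a b),
    fmap (cmp f g) = cmp (fmap f) (fmap g)
}.

Program Definition prod_category (C D : category) : category :=
  @Category (C * D)%type (fun a b => (hom a.1 b.1 * hom a.2 b.2)%type)
    (fun a => (idm a.1, idm a.2))
    (fun a b c f g => (cmp f.1 g.1, cmp f.2 g.2)) _ _ _.
Next Obligation. by rewrite /= !cmp_idl. Qed.
Next Obligation. by rewrite /= !cmp_idr. Qed.
Next Obligation. by rewrite /= !cmpA. Qed.

Program Definition comp_functor (C D E : category)
    (F : functor D E) (F' : functor C D) : functor C E :=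
  @Functor C E (fun a => F (F' a)) (fun a b f => fmap F (fmap F' f)) _ _.
Next Obligation. by rewrite !fmap_id. Qed.
Next Obligation. by rewrite !fmap_cmp. Qed.

Program Definition prod_functor (C C' D D' : category)
    (F : functor C D) (F' : functor C' D') :
    functor (prod_category C C') (prod_category D D') :=
  @Functor (prod_category C C') (prod_category D D')
    (fun a => (F a.1, F' a.2)) (fun a b f => (fmap F f.1, fmap F' f.2)) _ _.
Next Obligation. by rewrite /= !fmap_id. Qed.
Next Obligation. by rewrite /= !fmap_cmp. Qed.

Definition inverse_morphisms (C : category) (a b : C)
    (f : hom a b) (g : hom b a) :=
  cmp g f = idm a /\ cmp f g = idm b.

Record nat_iso (C D : category) (F F' : functor C D) := NatIso {
  ni_comp :> forall a, hom (F a) (F' a);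
  ni_natural : forall a b (f : hom a b),
    cmp (ni_comp b) (fmap F f) = cmp (fmap F' f) (ni_comp a);
  ni_iso : forall a, exists g, inverse_morphisms (ni_comp a) g
}.

Program Definition gmod (G : zmodType) (R : gradedRing G) : category :=
  @Category (gradedModule R) (@gradedHom G R) (@gid G R) (@gcomp G R) _ _ _.
Solve Obligations with by move=> *; apply: gradedHom_eq.

Section Functors.
Variables (G : zmodType).

Section TensorFunctor.
Variable R : gradedRing G.

Lemma gtensor_map_id (M N : gradedModule R) :
  gtensor_map (gid M) (gid N) = gid (gtensor M N).
Proof.
apply: gradedHom_eq; elim/tensor_ind => [|t w IHt IHw|x y].
- exact: raddf0.
- by rewrite [LHS]raddfB [X in X - _]IHt [X in _ - X]IHw.
- exact: tmap_tens.
Qed.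

Lemma gtensor_map_comp (M M' M'' N N' N'' : gradedModule R)
    (u : gradedHom M' M'') (u' : gradedHom M M')
    (v : gradedHom N' N'') (v' : gradedHom N N') :
  gtensor_map (gcomp u u') (gcomp v v') =
  gcomp (gtensor_map u v) (gtensor_map u' v').
Proof.
apply: gradedHom_eq; elim/tensor_ind => [|t w IHt IHw|x y].
- by rewrite !raddf0.
- by rewrite !raddfB; congr (_ - _).
- by rewrite /= !tmap_tens.
Qed.

Definition tensor_functor :
    functor (prod_category (gmod R) (gmod R)) (gmod R) :=
  @Functor (prod_category (gmod R) (gmod R)) (gmod R)
    (fun MN => gtensor MN.1 MN.2) (fun _ _ uv => gtensor_map uv.1 uv.2)
    (fun _ => gtensor_map_id _ _)
    (fun _ _ _ _ _ => gtensor_map_comp _ _ _ _).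

End TensorFunctor.

Variables (R S : gradedRing G) (h : gradedRingHom R S).

Lemma gext_map_id (M : gradedModule R) : gext_map h (gid M) = gid (gext h M).
Proof.
apply: gradedHom_eq => t; pose H := grestr h (gregular S).
have := congr1 (@gh_fun _ _ _ _) (gtensor_map_id H M).
by move/(congr1 (fun f => f t)).
Qed.

Lemma gext_map_comp (M M' M'' : gradedModule R)
    (u : gradedHom M' M'') (u' : gradedHom M M') :
  gext_map h (gcomp u u') = gcomp (gext_map h u) (gext_map h u').
Proof.
apply: gradedHom_eq => t; pose H := grestr h (gregular S).
have := congr1 (@gh_fun _ _ _ _) (gtensor_map_comp (gid H) (gid H) u u').
by move/(congr1 (fun f => f t)).
Qed.

Definition ext_functor : functor (gmod R) (gmod S) :=
  @Functor (gmod R) (gmod S) (gext h) (gext_map h)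
    gext_map_id (fun _ _ _ => @gext_map_comp _ _ _).

End Functors.

(* Main.v *)
Require Import Defs.
From mathcomp Require Import all_boot all_algebra finmap.

(** Extension of scalars is left adjoint to restriction, so a map out of
    [h^* M] is an [h]-semilinear map out of [M].  Applying this in each variable
    gives the bilinear map behind [delta]; the same universal property turns
    [x (x) y |-> (1 (x) x) (x) (1 (x) y)] into the inverse.  Both sides are
    generated over [S] by the elements with all [S]-factors equal to [1], so
    naturality and the two inverse laws need only be compared there.  The inverse
    preserves degrees because [1] has degree [0]. *)

Set Implicit Arguments.
Unset Strict Implicit.
Unset Printing Implicit Defensive.

Import GRing.Theory.
Local Open Scope ring_scope.

(** * Linear maps out of a tensor product *)

Section TensorLift.
Variables (R : comPzRingType) (M N P : lmodType R) (phi : M -> N -> P).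
Hypotheses (phil : forall y, linear (phi^~ y)) (phir : forall x, linear (phi x)).

Lemma bilinear_balanced : balanced phi.
Proof.
split=> [x x' y|x y y'|r x y].
- by have := phil y 1 x x'; rewrite /= !scale1r.
- by have := phir x 1 y y'; rewrite !scale1r.
- have := scalable_linear (phil y) r x; rewrite /= => ->.
  by rewrite (scalable_linear (phir x)).
Qed.

Lemma tlift_bilinear x y : tlift phi (tens x y) = phi x y.
Proof. exact: tlift_tens bilinear_balanced _ _. Qed.

(** Scalars act on the first factor of a pure tensor, so compatibility with scaling comes from
    linearity of [phi] in its first argument. *)
Lemma tlift_linear : linear (tlift phi).
Proof.
have tB := tlift_is_additive bilinear_balanced.
move=> r t u; rewrite (zmod_morphismD tB); congr (_ + _).
elim/tensor_ind: t => [|t w IHt IHw|x y].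
- by rewrite scaler0 (zmod_morphism0 tB) scaler0.
- by rewrite scalerBr !tB IHt IHw scalerBr.
- by rewrite scale_tens !tlift_bilinear; apply: (scalable_linear (phil y)).
Qed.

End TensorLift.

(** * Semilinear maps and extension of scalars *)

Section ScalarExtension.
Variables (R S : comPzRingType) (h : {rmorphism R -> S}).

(** Balancing moves [r] to the left factor, where restriction along [h] makes it act as
    multiplication by [h r]. *)
Lemma etensZ (M : lmodType R) s r (x : M) :
  etens h s (r *: x) = h r *: etens h s x.
Proof.
by rewrite scale_etens /etens -tens_bal; congr tens.
Qed.

(** The scaling law [h \; *:%R] encodes semilinearity: [r] acts on the target as [h r]. *)
Lemma etens_linear (M : lmodType R) s :
  linear_for (h \; *:%R) (@etens R S h M s).
Proof.
by move=> r x y /=; rewrite -etensZ; apply: tensDr.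
Qed.

Section Lift.
Variables (M : lmodType R) (P : lmodType S) (f : M -> P).
Hypothesis fL : linear_for (h \; *:%R) f.

(** The adjoint transpose of an [h]-semilinear map [f]. *)
Definition elift : extscal h M -> P :=
  tlift (fun (s : restr h S^o) x => (s : S) *: f x).

Lemma elift_balanced : balanced (fun (s : restr h S^o) x => (s : S) *: f x).
Proof.
(* Setting the added term to [0] in [fL] isolates compatibility with scaling, which requires
   [f 0 = 0]. *)
have f0 : f 0 = 0.
  by have := fL 1 0 0; rewrite /= rmorph1 !scale1r addr0 -[LHS]addr0 => /addrI.
split=> [s s' x|s x x'|r s x].
- exact: scalerDl.
- by have := fL 1 x x'; rewrite /= rmorph1 !scale1r => ->; rewrite scalerDr.
- have := fL r x 0; rewrite /= f0 !addr0 => ->.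
  by rewrite scalerA [s * _]mulrC.
Qed.

Lemma elift_etens s x : elift (etens h s x) = s *: f x.
Proof. exact: (tlift_tens elift_balanced). Qed.

Lemma elift_linear : linear elift.
Proof.
have eB : zmod_morphism elift := tlift_is_additive elift_balanced.
move=> r t u; rewrite (zmod_morphismD eB); congr (_ + _).
elim/extscal_ind: t => [|t w IHt IHw|s x].
- by rewrite scaler0 (zmod_morphism0 eB) scaler0.
- by rewrite scalerBr !eB IHt IHw scalerBr.
- rewrite (elift_etens s x) scalerA -(elift_etens (r * s) x); congr elift.
  exact: scale_etens.
Qed.

End Lift.
End ScalarExtension.

(** * Extensionality on generators and closure of linear maps *)

Lemma tens_linearl (R : comPzRingType) (M N : lmodType R) (y : N) :
  linear (fun x : M => tens x y).
Proof. by move=> r x x'; rewrite tensDl scale_tens. Qed.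

Lemma tens_linearr (R : comPzRingType) (M N : lmodType R) (x : M) :
  linear (fun y : N => tens x y).
Proof. by move=> r y y'; rewrite tensDr scale_tens tens_bal. Qed.

Lemma tensor_additive_ext (R : comPzRingType) (M N : lmodType R) (A : zmodType)
    (f g : tensor M N -> A) : zmod_morphism f -> zmod_morphism g ->
  (forall x y, f (tens x y) = g (tens x y)) -> f =1 g.
Proof.
move=> fB gB fg; elim/tensor_ind => [|t w IHt IHw|//].
- by rewrite (zmod_morphism0 fB) (zmod_morphism0 gB).
- by rewrite fB gB IHt IHw.
Qed.

Lemma comp_additive (U V W : zmodType) (f : V -> W) (g : U -> V) :
  zmod_morphism f -> zmod_morphism g -> zmod_morphism (f \o g).
Proof. by move=> fB gB u v; rewrite /= gB fB. Qed.

(** Commutativity of [R] lets [a] and the scalar [r] change places. *)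
Lemma linear_combination (R : comPzRingType) (V W : lmodType R) (a : R)
    (f g : V -> W) : linear f -> linear g -> linear (fun v => a *: f v + g v).
Proof.
by move=> fL gL r v w; rewrite fL gL !scalerDr !scalerA [a * r]mulrC addrACA.
Qed.

Lemma linear_comp (R : comPzRingType) (U V W : lmodType R)
    (f : V -> W) (g : U -> V) : linear f -> linear g -> linear (f \o g).
Proof. by move=> fL gL r u v; rewrite /= gL fL. Qed.

(** * The distributivity isomorphism without gradings *)

Section BaseChange.
Variables (R S : comPzRingType) (h : {rmorphism R -> S}).

(** Since [etens h s x = s *: etens h 1 x], the elements [etens h 1 x] generate over [S]. *)
Lemma extscal_linear_ext (M : lmodType R) (P : lmodType S)
    (f g : extscal h M -> P) : linear f -> linear g ->
  (forall x, f (etens h 1 x) = g (etens h 1 x)) -> f =1 g.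
Proof.
move=> fL gL fg.
have fB := zmod_morphism_linear fL; have gB := zmod_morphism_linear gL.
elim/extscal_ind => [|t w IHt IHw|s x].
- by rewrite (zmod_morphism0 fB) (zmod_morphism0 gB).
- by rewrite fB gB IHt IHw.
- have -> : etens h s x = s *: etens h 1 x by rewrite scale_etens mulr1.
  by rewrite (scalable_linear fL) (scalable_linear gL) /= fg.
Qed.

(** With one tensor factor fixed, [f] and [g] are [S]-linear in the other, so the previous criterion
    applies to each factor in turn. *)
Lemma tensor_extscal_linear_ext (M N : lmodType R) (P : lmodType S)
    (f g : tensor (extscal h M) (extscal h N) -> P) : linear f -> linear g ->
  (forall x y, f (tens (etens h 1 x) (etens h 1 y)) =
               g (tens (etens h 1 x) (etens h 1 y))) -> f =1 g.
Proof.
move=> fL gL fg.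
apply: tensor_additive_ext; try exact: zmod_morphism_linear.
move=> a b; move: a.
apply: extscal_linear_ext => [r a a'|r a a'|x].
- by rewrite tens_linearl fL.
- by rewrite tens_linearl gL.
move: b; apply: extscal_linear_ext => [r b b'|r b b'|y //].
- by rewrite tens_linearr fL.
- by rewrite tens_linearr gL.
Qed.

Variables M N : lmodType R.

Definition dist_inner (x : M) : extscal h N -> extscal h (tensor M N) :=
  elift (fun y => etens h 1 (tens x y)).

Lemma dist_inner_semilinear (x : M) :
  linear_for (h \; *:%R) (fun y : N => etens h 1 (tens x y)).
Proof. by move=> r y y'; rewrite tens_linearr etens_linear. Qed.

Lemma dist_inner_linear x : linear (dist_inner x).
Proof. exact: elift_linear (dist_inner_semilinear x). Qed.

Lemma dist_inner_etens x s y : dist_inner x (etens h s y) = etens h s (tens x y).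
Proof.
by rewrite /dist_inner (elift_etens (dist_inner_semilinear x)) scale_etens mulr1.
Qed.

(** Both sides are [S]-linear in [b]; on [etens h 1 y] the identity is linearity of [tens x y] in
    [x]. This permits the second lift, in the variable from [M]. *)
Lemma dist_outer_semilinear b : linear_for (h \; *:%R) (dist_inner^~ b).
Proof.
move=> r x x'; move: b; apply: extscal_linear_ext => [|s b b'|y].
- exact: dist_inner_linear.
- exact: linear_combination (dist_inner_linear x) (dist_inner_linear x') _ _ _.
- by rewrite /= !dist_inner_etens tens_linearl etens_linear.
Qed.

Definition dist_fun (a : extscal h M) (b : extscal h N) : extscal h (tensor M N) :=
  elift (dist_inner^~ b) a.

Lemma dist_fun_linearl b : linear (dist_fun^~ b).
Proof. exact: elift_linear (dist_outer_semilinear b). Qed.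

Lemma dist_fun_etens r s x y :
  dist_fun (etens h r x) (etens h s y) = etens h (r * s) (tens x y).
Proof.
by rewrite /dist_fun (elift_etens (dist_outer_semilinear _)) dist_inner_etens
  scale_etens.
Qed.

(** The lift in [a] treats [b] as a parameter. Both sides being [S]-linear in [a], it suffices to
    take [a = etens h 1 x], where [dist_fun a] is [dist_inner x]. *)
Lemma dist_fun_linearr a : linear (dist_fun a).
Proof.
move=> s b b'; move: a; apply: extscal_linear_ext => [|r a a'|x].
- exact: dist_fun_linearl.
- exact: linear_combination (dist_fun_linearl b) (dist_fun_linearl b') _ _ _.
rewrite /dist_fun !(elift_etens (dist_outer_semilinear _)) !scale1r.
exact: dist_inner_linear.
Qed.

Definition dist : tensor (extscal h M) (extscal h N) -> extscal h (tensor M N) :=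
  tlift dist_fun.

Lemma dist_linear : linear dist.
Proof. exact: (tlift_linear dist_fun_linearl dist_fun_linearr). Qed.

Lemma dist_tens r s x y :
  dist (tens (etens h r x) (etens h s y)) = etens h (r * s) (tens x y).
Proof.
by rewrite /dist (tlift_bilinear dist_fun_linearl dist_fun_linearr) dist_fun_etens.
Qed.

Definition codist_fun (x : M) (y : N) : tensor (extscal h M) (extscal h N) :=
  tens (etens h 1 x) (etens h 1 y).

(** A scalar [r] leaves either factor as [h r], which balancing over [S] carries across. *)
Lemma codist_fun_balanced : balanced codist_fun.
Proof.
have D (L : lmodType R) (x x' : L) :
    etens h 1 (x + x') = etens h 1 x + etens h 1 x' by apply: tensDr.
split=> [x x' y|x y y'|r x y]; rewrite /codist_fun.
- by rewrite D tensDl.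
- by rewrite D tensDr.
- by rewrite !etensZ tens_bal.
Qed.

Lemma codist_semilinear : linear_for (h \; *:%R) (tlift codist_fun).
Proof.
have tB := tlift_is_additive codist_fun_balanced.
move=> r t u; rewrite (zmod_morphismD tB); congr (_ + _) => /=.
elim/tensor_ind: t => [|t w IHt IHw|x y].
- by rewrite scaler0 (zmod_morphism0 tB) scaler0.
- by rewrite scalerBr !tB IHt IHw scalerBr.
rewrite scale_tens !(tlift_tens codist_fun_balanced) /codist_fun.
by rewrite etensZ scale_tens.
Qed.

Definition codist : extscal h (tensor M N) -> tensor (extscal h M) (extscal h N) :=
  elift (tlift codist_fun).

Lemma codist_linear : linear codist.
Proof. exact: elift_linear codist_semilinear. Qed.

Lemma codist_etens s x y :
  codist (etens h s (tens x y)) = s *: tens (etens h 1 x) (etens h 1 y).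
Proof.
by rewrite /codist (elift_etens codist_semilinear) (tlift_tens codist_fun_balanced).
Qed.

Lemma distK : cancel dist codist.
Proof.
apply: tensor_extscal_linear_ext => [s t u|//|x y].
- by rewrite dist_linear codist_linear.
- by rewrite dist_tens codist_etens mulr1 scale1r.
Qed.

Lemma codistK : cancel codist dist.
Proof.
apply: extscal_linear_ext => [|//|].
  exact: linear_comp dist_linear codist_linear.
(* What remains is [etens h 1 t] with [t] an arbitrary tensor over [R]; additivity in [t] reduces it
   to pure tensors. *)
have dcB := comp_additive (zmod_morphism_linear dist_linear)
  (zmod_morphism_linear codist_linear).
have eB : zmod_morphism (@etens R S h (tensor M N) 1) by apply: tens_is_additiver.
apply: (tensor_additive_ext (comp_additive dcB eB) eB) => x y.
by rewrite /= codist_etens scale1r dist_tens mulr1.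
Qed.

End BaseChange.

Arguments dist {R S} h M N t.
Arguments codist {R S} h M N t.

(** * Degrees of the two morphisms *)

(* The degree-0 component [e 0] of [1] satisfies [e 0 * x = x] for homogeneous
   [x], by comparing degrees in [x = 1 * x]; hence [e 0 = 1]. *)
Lemma gr_deg_one (G : zmodType) (R : gradedRing G) : 1 \in gr_deg R 0.
Proof.
pose e := component (gr_direct R) 1.
suff e0 x : e 0 * x = x by rewrite -[1]e0 mulr1; apply: component_in.
move: x; apply: (direct_sum_ind (gr_direct R)) => [|x y IHx IHy|a x xa].
- exact: mulr0.
- by rewrite mulrDr IHx IHy.
rewrite -[RHS](_ : component (gr_direct R) x a = x); last first.
  by rewrite (component_homog _ xa) eqxx.
rewrite (@component_unique _ _ _ (gr_direct R) x (fun g => e (g - a) * x)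
  [seq g + a | g <- finsupp e]) ?subrr //.
- by rewrite (map_inj_uniq (@addIr _ a)); apply: fset_uniq.
- move=> g; rewrite -[g in gr_deg R g](subrK a).
  by apply: gr_mul => //; apply: component_in.
- move=> g gd; rewrite (fsfun_dflt (k := g - a)) ?mul0r //.
  by apply: contra gd => gd; apply/mapP; exists (g - a); rewrite ?subrK.
- rewrite big_map (eq_bigr (fun g => e g * x)); last by move=> g _; rewrite addrK.
  by rewrite -mulr_suml -component_sum mul1r.
Qed.

(** The degree [a] part is spanned by homogeneous pure tensors, and the preimage of [D] under [f] is
    a subgroup. Stating this with [f] explicit allows nested use on iterated tensors. *)
Lemma tensor_deg_ind (G : zmodType) (R : gradedRing G) (M N : gradedModule R)
    (A : zmodType) (D : {pred A}) (f : tensor M N -> A) (a : G) :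
  zmod_closed D -> zmod_morphism f ->
  (forall b c x y, x \in gm_deg M b -> y \in gm_deg N c -> b + c = a ->
     f (tens x y) \in D) ->
  forall t, t \in gm_deg (gtensor M N) a -> f t \in D.
Proof.
move=> [D0 DB] fB fD; apply: zspan_ind => [|t w ft fw|w].
- by rewrite (zmod_morphism0 fB).
- by rewrite fB; apply: DB.
- by move=> [b [c [x [y [xb yc bc ->]]]]]; apply: fD bc.
Qed.

Lemma gtensor_deg_tens (G : zmodType) (R : gradedRing G) (M N : gradedModule R)
    a b (x : M) (y : N) : x \in gm_deg M a -> y \in gm_deg N b ->
  tens x y \in gm_deg (gtensor M N) (a + b).
Proof. by move=> xa yb; apply: zspan_gen; exists a, b, x, y. Qed.

Section GradedBaseChange.
Variables (G : zmodType) (R S : gradedRing G) (h : gradedRingHom R S).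

(** [gext h M] shares carrier and grading with the graded tensor product over [R] of restricted [S]
    and [M]. *)
Lemma gext_deg_ind (M : gradedModule R) (A : zmodType) (D : {pred A})
    (f : extscal h M -> A) (a : G) :
  zmod_closed D -> zmod_morphism f ->
  (forall b c s x, s \in gr_deg S b -> x \in gm_deg M c -> b + c = a ->
     f (etens h s x) \in D) ->
  forall t, t \in gm_deg (gext h M) a -> f t \in D.
Proof. exact: (@tensor_deg_ind G R (grestr h (gregular S)) M). Qed.

Lemma gext_deg_etens (M : gradedModule R) a b (s : S) (x : M) :
  s \in gr_deg S a -> x \in gm_deg M b ->
  etens h s x \in gm_deg (gext h M) (a + b).
Proof. exact: (@gtensor_deg_tens G R (grestr h (gregular S)) M). Qed.

Lemma gext_deg_etens1 (M : gradedModule R) a (x : M) :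
  x \in gm_deg M a -> etens h 1 x \in gm_deg (gext h M) a.
Proof.
move=> xa; have := gext_deg_etens (gr_deg_one S) xa.
by rewrite add0r.
Qed.

Variables M N : gradedModule R.

Lemma dist_deg a (t : gtensor (gext h M) (gext h N)) :
  t \in gm_deg (gtensor (gext h M) (gext h N)) a ->
  (dist h M N t : gext h (gtensor M N)) \in gm_deg (gext h (gtensor M N)) a.
Proof.
have Dz := (gm_direct (gext h (gtensor M N))).1 a.
have dB := zmod_morphism_linear (@dist_linear _ _ h M N).
move: t; apply: (@tensor_deg_ind _ _ (gext h M) (gext h N) _ _ _ _ Dz dB).
(* Each of [u] and [v] is itself reduced to homogeneous [etens], the other factor being held
   fixed. *)
move=> b c u v ub vc bc; move: u ub.
apply: (@gext_deg_ind _ _ _ _ _ Dz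
  (comp_additive dB (zmod_morphism_linear (tens_linearl v)))).
move=> b1 b2 r x rb1 xb2 b12; move: v vc.
apply: (@gext_deg_ind _ _ _ _ _ Dz
  (comp_additive dB (zmod_morphism_linear (tens_linearr (etens h r x))))).
move=> c1 c2 s y sc1 yc2 c12.
have := gext_deg_etens (gr_mul rb1 sc1) (gtensor_deg_tens xb2 yc2).
(* The ring degrees [b1], [c1] and module degrees [b2], [c2] are regrouped by tensor factor. *)
rewrite addrACA b12 c12 bc.
by rewrite -dist_tens.
Qed.

Definition gdist : gradedHom (gtensor (gext h M) (gext h N)) (gext h (gtensor M N)) :=
  @GradedHom G S (gtensor (gext h M) (gext h N)) (gext h (gtensor M N))
    (dist h M N) (@dist_linear _ _ h M N) dist_deg.

Lemma codist_deg a (t : gext h (gtensor M N)) :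
  t \in gm_deg (gext h (gtensor M N)) a ->
  (codist h M N t : gtensor (gext h M) (gext h N))
    \in gm_deg (gtensor (gext h M) (gext h N)) a.
Proof.
have Dz := (gm_direct (gtensor (gext h M) (gext h N))).1 a.
have cB := zmod_morphism_linear (@codist_linear _ _ h M N).
move: t; apply: (@gext_deg_ind (gtensor M N) _ _ _ _ Dz cB).
move=> b c s u sb uc bc; move: u uc.
have eB : zmod_morphism (@etens R S h (gtensor M N) s) by apply: tens_is_additiver.
apply: (@tensor_deg_ind _ _ M N _ _ _ _ Dz (comp_additive cB eB)).
move=> c1 c2 x y xc1 yc2 c12.
(* The factors [1] contribute degree [0], so the image has degree [b + (c1 + c2)]. *)
have := gm_scale sb
  (gtensor_deg_tens (gext_deg_etens1 xc1) (gext_deg_etens1 yc2)).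
rewrite c12 bc.
by rewrite -codist_etens.
Qed.

Definition gcodist : gradedHom (gext h (gtensor M N)) (gtensor (gext h M) (gext h N)) :=
  @GradedHom G S (gext h (gtensor M N)) (gtensor (gext h M) (gext h N))
    (codist h M N) (@codist_linear _ _ h M N) codist_deg.

End GradedBaseChange.

Lemma gtensor_map_tens (G : zmodType) (R : gradedRing G)
    (M N M' N' : gradedModule R) (u : gradedHom M M') (v : gradedHom N N') x y :
  gtensor_map u v (tens x y) = tens (u x) (v y).
Proof. exact: tmap_tens. Qed.

(** * Naturality and the isomorphism of bifunctors *)

Section Naturality.
Variables (G : zmodType) (R S : gradedRing G) (h : gradedRingHom R S).

Lemma gdist_natural (M M' N N' : gradedModule R)
    (u : gradedHom M M') (v : gradedHom N N') :
  gcomp (gdist h M' N') (gtensor_map (gext_map h u) (gext_map h v)) =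
  gcomp (gext_map h (gtensor_map u v)) (gdist h M N).
Proof.
apply: gradedHom_eq.
set f := gcomp _ _; set g := gcomp _ _.
apply: (@tensor_extscal_linear_ext R S h M N (gext h (gtensor M' N')) f g
  (gh_linear f) (gh_linear g)).
(* On generators both composites give [etens h (1 * 1) (tens (u x) (v y))]. *)
move=> x y; rewrite /f /g /=.
have mapE : gtensor_map (gext_map h u) (gext_map h v)
    (tens (etens h 1 x) (etens h 1 y)) =
    tens (etens h 1 (u x)) (etens h 1 (v y)).
  apply: etrans (@gtensor_map_tens _ _ _ _ _ _ (gext_map h u) (gext_map h v) _ _) _.
  by rewrite !gext_map_tens.
apply: etrans (congr1 (dist h M' N') mapE) _.
apply: etrans (dist_tens h _ _ _ _) _; apply: esym.
apply: etrans (congr1 (gext_map h (gtensor_map u v)) (dist_tens h _ _ _ _)) _.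
apply: etrans (@gext_map_tens _ _ _ h _ _ (gtensor_map u v) (1 * 1) (tens x y)) _.
by rewrite gtensor_map_tens.
Qed.

Lemma gdist_inverse (M N : gradedModule R) :
  @inverse_morphisms (gmod S) _ _ (gdist h M N) (gcodist h M N).
Proof. by split; apply: gradedHom_eq; [apply: distK | apply: codistK]. Qed.

Definition gdist_nat_iso : nat_iso
    (comp_functor (tensor_functor S)
       (prod_functor (ext_functor h) (ext_functor h)))
    (comp_functor (ext_functor h) (tensor_functor R)) :=
  @NatIso _ _
    (comp_functor (tensor_functor S)
       (prod_functor (ext_functor h) (ext_functor h)))
    (comp_functor (ext_functor h) (tensor_functor R))
    (fun MN => gdist h MN.1 MN.2)
    (fun _ _ uv => gdist_natural uv.1 uv.2)
    (fun MN => ex_intro _ (gcodist h MN.1 MN.2) (gdist_inverse MN.1 MN.2)).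

End Naturality.

Theorem mainTheorem12 (G : zmodType) (R S : gradedRing G)
    (h : gradedRingHom R S) :
  exists delta : forall M N : gradedModule R,
      gradedHom (gtensor (gext h M) (gext h N)) (gext h (gtensor M N)),
    [/\ (forall (M N : gradedModule R) (r s : S) (x : M) (y : N),
           ring_homogeneous r -> ring_homogeneous s ->
           homogeneous x -> homogeneous y ->
           delta M N (tens (etens h r x) (etens h s y)) =
           etens h (r * s) (tens x y)),
        (forall (M M' N N' : gradedModule R)
                (u : gradedHom M M') (v : gradedHom N N'),
           gcomp (delta M' N') (gtensor_map (gext_map h u) (gext_map h v)) =
           gcomp (gext_map h (gtensor_map u v)) (delta M N)),
        (forall M N : gradedModule R,
           exists epsilon : gradedHom (gext h (gtensor M N))
                                      (gtensor (gext h M) (gext h N)),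
             @inverse_morphisms (gmod S) _ _ (delta M N) epsilon /\
             forall (s : S) (x : M) (y : N),
               epsilon (etens h s (tens x y)) =
               s *: tens (etens h 1 x) (etens h 1 y))
      & exists eta : nat_iso
            (comp_functor (tensor_functor S)
               (prod_functor (ext_functor h) (ext_functor h)))
            (comp_functor (ext_functor h) (tensor_functor R)),
          forall M N : gradedModule R, eta (M, N) = delta M N].
Proof.
exists (gdist h); split=> [M N r s x y _ _ _ _|M M' N N' u v|M N|].
- exact: dist_tens.
- exact: gdist_natural.
- exists (gcodist h M N); split; first exact: gdist_inverse.
  exact: codist_etens.
- by exists (gdist_nat_iso h).
Qed.
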